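(* For any nontrivial irreducible type $\tau$ whose block decomposition has $b\ge 2$ blocks and every positive integer $n$ (at least the width of $\tau$), there is a graph homomorphism $\phi\colon G(n,\tau)\to G_{b-1}(n)$.
   Context: For finite sets $X,Y\subseteq\mathbb{Q}$ with $X\cup Y=\{z_1<\dots<z_\ell\}$, the order type $\tau(X,Y)$ is the sequence $(\tau_1,\dots,\tau_\ell)$ with $\tau_i=1$ if $z_i\in X\setminus Y$, $2$ if $z_i\in Y\setminus X$, $3$ if $z_i\in X\cap Y$. A type of width $k$ is the order type of a pair $(X,Y)$ with $|X|=|Y|=k$. A type is trivial if all entries equal $3$. A nonempty type is irreducible if it is not the concatenation of two nonempty types; a nontrivial irreducible type is primary if it starts with $1$, secondary if it starts with $2$. $\mathbf{1}(B)$ (resp. $\mathbf{2}(B)$) is the number of entries of a sequence $B$ equal to $1$ or $3$ (resp. $2$ or $3$). Block decomposition of a primary irreducible type $\tau$: $B_1$ is the maximal initial run of ones; once $B_i$ is constructed, $B_{i+1}$ consists of the next consecutive entries with $\mathbf{2}(B_{i+1})=\mathbf{1}(B_i)$ and, subject to this, as long as possible; stop when all entries are placed, giving $\tau=B_1\cdots B_b$. For a secondary irreducible type, interchange ones and twos, decompose, and interchange back. The type-graph $G(n,\tau)$ for a nontrivial type of width $k$ has vertex set $\binom{[n]}{k}$, with $X,Y$ adjacent iff $\tau(X,Y)=\tau$ or $\tau(Y,X)=\tau$. For positive integers $b,n$, let $V_b(n)$ be the set of tuples $(x_1,\dots,x_{2b-1})$ of integers with $1\le x_1\le x_2\le\dots\le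 x_{2b-1}\le n$ and $x_1<x_3<\dots<x_{2b-1}$; $G_b(n)$ is the graph on $V_b(n)$ in which $\{\mathbf{x},\mathbf{y}\}$ is an edge iff one can write $\mathbf{x}=(x_1,\dots,x_{2b-1})$, $\mathbf{y}=(y_1,\dots,y_{2b-1})$ (in some order of the two vertices) with (i) $x_1<y_1\le x_3<y_3\le\dots\le x_{2b-1}<y_{2b-1}$ and (ii) $x_{j+1}\le y_j$ for all $j\in[2b-2]$. *)

(* Defs.v *)
From mathcomp Require Import all_boot all_order all_algebra finmap.

Set Implicit Arguments.
Unset Strict Implicit.
Unset Printing Implicit Defensive.

(* Order types are sequences over {1, 2, 3}, encoded as sequences of natural
   numbers; the predicate [type_of_width] singles out the actual types. *)

Definition entry {d} {T : orderType d} (X Y : {fset T}) (z : T) : nat :=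
  if (z \in X) && (z \in Y) then 3 else if z \in X then 1 else 2.

Definition order_type {d} {T : orderType d} (X Y : {fset T}) : seq nat :=
  [seq entry X Y z | z <- sort <=%O (X `|` Y)%fset].

Definition type_of_width (k : nat) (t : seq nat) : Prop :=
  exists X Y : {fset rat}, [/\ #|` X| = k, #|` Y| = k & order_type X Y = t].

Definition is_type (t : seq nat) : Prop := exists k, type_of_width k t.

Definition trivial_type (t : seq nat) : bool := all (pred1 3) t.

Definition irreducible (t : seq nat) : Prop :=
  [/\ is_type t, t <> [::]
    & ~ exists s1 s2, [/\ is_type s1, is_type s2, s1 <> [::], s2 <> [::]
                        & t = s1 ++ s2]].

Definition primary (t : seq nat) : Prop :=
  [/\ irreducible t, ~~ trivial_type t & ohead t = Some 1].

Definition secondary (t : seq nat) : Prop :=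
  [/\ irreducible t, ~~ trivial_type t & ohead t = Some 2].

Definition ones (B : seq nat) : nat := count (mem [:: 1; 3]) B.
Definition twos (B : seq nat) : nat := count (mem [:: 2; 3]) B.

Definition longest_prefix (P : pred (seq nat)) (s B : seq nat) : Prop :=
  [/\ prefix B s, P B
    & forall C, prefix C s -> P C -> size C <= size B].

(* [blocks_from P s Bs]: cutting [s] greedily gives the blocks [Bs], where the
   first block is the longest prefix satisfying [P] and each block [B] is
   followed by the longest block [C] with [twos C = ones B]; the process stops
   exactly when no entry is left. *)
Inductive blocks_from : pred (seq nat) -> seq nat -> seq (seq nat) -> Prop :=
| blocks_nil P : blocks_from P [::] [::]
| blocks_cons P s B Bs :
    s <> [::] -> longest_prefix P s B ->
    blocks_from (fun C => twos C == ones B) (drop (size B) s) Bs ->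
    blocks_from P s (B :: Bs).

Definition primary_blocks (t : seq nat) (Bs : seq (seq nat)) : Prop :=
  blocks_from (all (pred1 1)) t Bs.

Definition swap12 (c : nat) : nat :=
  if c == 1 then 2 else if c == 2 then 1 else c.

Definition block_decomposition (t : seq nat) (Bs : seq (seq nat)) : Prop :=
  (primary t /\ primary_blocks t Bs) \/
  (secondary t /\
   exists2 Cs, primary_blocks (map swap12 t) Cs & Bs = map (map swap12) Cs).

Record graph := Graph { vertex : Type; adj : vertex -> vertex -> Prop }.

Definition is_homomorphism (G H : graph) (phi : vertex G -> vertex H) : Prop :=
  forall x y, adj x y -> adj (phi x) (phi y).

Definition ksubset (n k : nat) : Type :=
  {X : {fset nat} | (X `<=` [fset i in iota 1 n])%fset && (#|` X| == k)}.

(* Meant for nontrivial types [t] of width [k]. *)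
Definition type_graph (n k : nat) (t : seq nat) : graph :=
  @Graph (ksubset n k) (fun X Y =>
    order_type (val X) (val Y) = t \/ order_type (val Y) (val X) = t).

(* One-based coordinates: [coord1 x j] is x_j. *)
Definition coord1 (x : seq nat) (j : nat) : nat := nth 0 x j.-1.

Definition in_V (b n : nat) (x : seq nat) : bool :=
  [&& all (fun c => 1 <= c <= n) x, sorted leq x
    & sorted ltn [seq coord1 x (2 * i - 1) | i <- iota 1 b]].

Definition V (b n : nat) : Type := {x : (2 * b - 1).-tuple nat | in_V b n x}.

Definition G_arc (b : nat) (x y : seq nat) : Prop :=
  [/\ forall i, 1 <= i <= b -> coord1 x (2 * i - 1) < coord1 y (2 * i - 1),
      forall i, 1 <= i < b -> coord1 y (2 * i - 1) <= coord1 x (2 * i + 1)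
    & forall j, 1 <= j <= 2 * b - 2 -> coord1 x j.+1 <= coord1 y j].

Definition G_graph (b n : nat) : graph :=
  @Graph (V b n) (fun x y => G_arc b (val x) (val y) \/ G_arc b (val y) (val x)).

(* Main.v *)
(* Suppose [t] is primary. Give the block [B_i] its [ones B_i] elements of [X]
   and its [ones B_(i-1)] elements of [Y]; thus the i-th chunk of [X] lies in
   [B_i] and the i-th chunk of [Y] in [B_(i+1)]. Maximality of [B_i] makes
   [B_(i+1)] start with an element of [Y], and irreducibility means that every
   proper prefix of [t] has more ones than twos. Sending a set to the minima and
   maxima of its chunks is then the required homomorphism. A secondary type is
   handled by exchanging [X] and [Y]. *)
Require Import Defs.
From mathcomp Require Import all_boot all_order all_algebra finmap zify.

Set Implicit Arguments.
Unset Strict Implicit.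
Unset Printing Implicit Defensive.

(** * Counting entries of order types *)

Lemma filter_sort_fsetU d (T : orderType d) (X Y : {fset T}) :
  [seq z <- sort <=%O (X `|` Y)%fset | z \in X] = sort <=%O X.
Proof.
apply: Order.POrderTheory.lt_sorted_eq.
- by rewrite sorted_filter ?Order.TotalTheory.sort_lt_sorted ?fset_uniq //;
    exact: Order.POrderTheory.lt_trans.
- by rewrite Order.TotalTheory.sort_lt_sorted fset_uniq.
by move=> z; rewrite mem_filter !mem_sort in_fsetU; case: (z \in X).
Qed.

Lemma order_typeC d (T : orderType d) (X Y : {fset T}) :
  order_type Y X = map swap12 (order_type X Y).
Proof.
rewrite /order_type -map_comp fsetUC; apply/eq_in_map => z.
rewrite mem_sort in_fsetU /= /entry.
by case: (z \in X); case: (z \in Y).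
Qed.

Lemma ones_swap12 t : ones (map swap12 t) = twos t.
Proof.
by rewrite /ones /twos count_map; apply: eq_count => -[|[|[|[|c]]]].
Qed.

Lemma swap12K : involutive swap12.
Proof. by case=> [|[|[]]]. Qed.

Lemma twos_swap12 t : twos (map swap12 t) = ones t.
Proof. by rewrite -ones_swap12 (mapK swap12K). Qed.

Lemma ones_take_order_type d (T : orderType d) (X Y : {fset T}) l :
  ones (take l (order_type X Y)) =
  count (mem X) (take l (sort <=%O (X `|` Y)%fset)).
Proof.
rewrite /ones /order_type -map_take count_map; apply: eq_count => z /=.
by rewrite /entry; case: (z \in X); case: (z \in Y).
Qed.

Lemma twos_take_order_type d (T : orderType d) (X Y : {fset T}) l :
  twos (take l (order_type X Y)) =
  count (mem Y) (take l (sort <=%O (X `|` Y)%fset)).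
Proof.
by rewrite -ones_swap12 map_take -order_typeC ones_take_order_type fsetUC.
Qed.

Lemma ones_order_type d (T : orderType d) (X Y : {fset T}) :
  ones (order_type X Y) = #|` X|.
Proof.
rewrite -[order_type X Y]take_size ones_take_order_type size_map take_size.
by rewrite -size_filter filter_sort_fsetU size_sort.
Qed.

Lemma twos_order_type d (T : orderType d) (X Y : {fset T}) :
  twos (order_type X Y) = #|` Y|.
Proof. by rewrite -ones_swap12 -order_typeC ones_order_type. Qed.

Lemma all_order_type d (T : orderType d) (X Y : {fset T}) :
  all (mem [:: 1; 2; 3]) (order_type X Y).
Proof.
apply/allP => c /mapP[z _ ->] /=.
by rewrite /entry; case: (z \in X); case: (z \in Y).
Qed.

(** For the converse, entry [i] is realized at the rational [i], put into [X], [Y] or both as the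
    entry dictates. This makes being a type a matter of counting. *)
Lemma is_typeP t :
  is_type t <-> all (mem [:: 1; 2; 3]) t /\ ones t = twos t.
Proof.
split=> [[k [X [Y [Xk Yk <-]]]]|[t123 t_bal]].
  by rewrite all_order_type ones_order_type twos_order_type Xk Yk.
pose z : seq rat := [seq i%:R%R | i <- iota 0 (size t)].
have szz : size z = size t by rewrite size_map size_iota.
have z_sorted : sorted <%O z.
  rewrite sorted_map; apply: sub_sorted (iota_ltn_sorted 0 (size t)) => i j /=.
  by rewrite Num.Theory.ltr_nat.
have z_uniq : uniq z := Order.POrderTheory.lt_sorted_uniq z_sorted.
pose f (A : seq nat) : {fset rat} := [fset x in z | nth 0 t (index x z) \in A]%fset.
pose X := f [:: 1; 3]; pose Y := f [:: 2; 3].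
have in_f i A : i < size t -> (nth 0%R z i \in f A) = (nth 0 t i \in A).
  by move=> lt_i; rewrite !inE /= mem_nth ?szz // index_uniq ?szz.
have t_entry i : i < size t -> nth 0 t i \in [:: 1; 2; 3].
  by move=> lt_i; apply: (allP t123); exact: mem_nth.
have XYz : sort <=%O (X `|` Y)%fset = z.
  apply: Order.POrderTheory.lt_sorted_eq => //.
    by rewrite Order.TotalTheory.sort_lt_sorted fset_uniq.
  move=> x; rewrite mem_sort in_fsetU.
  apply/idP/idP; first by rewrite !inE /= -andb_orr => /andP[].
  move=> /(nthP 0%R)[i]; rewrite szz => lt_i <-; rewrite !in_f //.
  by have := t_entry i lt_i; rewrite !inE => /or3P[]/eqP->.
have XYt : order_type X Y = t.
  rewrite /order_type XYz; apply: (@eq_from_nth _ 0); rewrite size_map szz // => i lt_i.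
  rewrite (nth_map 0%R) ?szz // /entry !in_f //.
  by have := t_entry i lt_i; rewrite !inE => /or3P[]/eqP->.
exists #|` X|, X, Y; split=> //.
by rewrite -(twos_order_type X Y) -(ones_order_type X Y) XYt.
Qed.

(** Since [t] is balanced, a balanced proper prefix would leave a balanced remainder, and by
    [is_typeP] both would be types. *)
Lemma irreducible_prefix t l :
  irreducible t -> 0 < l < size t -> ones (take l t) <> twos (take l t).
Proof.
case=> /is_typeP[t123 t_bal] _ t_irr /andP[l_gt0 lt_l] l_bal; apply: t_irr.
move: t123 t_bal; rewrite -{1 2 3}(cat_take_drop l t) all_cat /ones /twos !count_cat.
move=> /andP[a1 a2] bal.
exists (take l t), (drop l t); rewrite cat_take_drop; split=> //.
- exact/is_typeP.
- apply/is_typeP; split=> //.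
  by apply/eqP; rewrite -(eqn_add2l (ones (take l t))) {2}l_bal; apply/eqP.
- by move/(congr1 size); rewrite size_takel ?(ltnW lt_l) // => l0; rewrite l0 in l_gt0.
- by move/(congr1 size)/eqP; rewrite size_drop subn_eq0 leqNgt lt_l.
Qed.

(** * Comparing elements of two sets through prefixes of their order type *)

Lemma sorted_ltn_fset (X : {fset nat}) : sorted ltn (sort <=%O X).
Proof.
have: sorted <%O (sort <=%O X).
  by rewrite Order.TotalTheory.sort_lt_sorted fset_uniq.
by apply: sub_sorted => i j; rewrite Order.NatOrder.ltEnat.
Qed.

Section Interleaving.

Variables (X Y : {fset nat}) (l : nat).
Let t := order_type X Y.
Let z := sort <=%O (X `|` Y)%fset.

Let z_sorted : sorted ltn z := sorted_ltn_fset _.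

Let nthX_take i m :
  i < ones (take m t) ->
  exists2 p, p < m & nth 0 (sort <=%O X) i = nth 0 z p /\ p < size z.
Proof.
rewrite ones_take_order_type -(filter_sort_fsetU X Y) -/z => lt_i.
have : nth 0 [seq c <- z | c \in X] i \in take m z.
  rewrite -{1}(cat_take_drop m z) filter_cat nth_cat size_filter lt_i.
  have := mem_nth 0 (s := [seq c <- take m z | c \in X]) (n := i).
  by rewrite size_filter => /(_ lt_i); rewrite mem_filter => /andP[].
case/(nthP 0)=> p; rewrite size_take_min leq_min => /andP[lt_pm lt_pz].
by rewrite nth_take // => <-; exists p.
Qed.

Let nthY_drop j :
  twos (take l t) <= j < #|` Y| ->
  exists2 q, l <= q < size z & nth 0 (sort <=%O Y) j = nth 0 z q.
Proof.
rewrite twos_take_order_type -/z => /andP[le_j lt_j].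
have eY : [seq c <- z | c \in Y] = sort <=%O Y.
  by rewrite /z fsetUC filter_sort_fsetU.
have : nth 0 [seq c <- z | c \in Y] j \in drop l z.
  move: lt_j; rewrite -(size_sort <=%O) -eY -{1 2}(cat_take_drop l z).
  rewrite filter_cat nth_cat size_cat !size_filter => lt_j.
  rewrite ltnNge le_j /=.
  have := mem_nth 0 (s := [seq c <- drop l z | c \in Y]) (n := j - count (mem Y) (take l z)).
  rewrite size_filter ltn_subLR // => /(_ lt_j).
  by rewrite mem_filter => /andP[].
case/(nthP 0)=> q; rewrite size_drop ltn_subRL nth_drop eY => lt_q <-.
by exists (l + q); rewrite ?leq_addr.
Qed.

(** The element of [X] is among the [l] smallest of the union, the element of [Y] is not. *)
Lemma order_type_lt i j :
  i < ones (take l t) -> twos (take l t) <= j < #|` Y| ->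
  nth 0 (sort <=%O X) i < nth 0 (sort <=%O Y) j.
Proof.
move=> /nthX_take[p lt_p [-> p_z]] /nthY_drop[q /andP[le_q q_z] ->].
by rewrite (sorted_ltn_nth ltn_trans) // (leq_trans lt_p).
Qed.

(** Here both elements may sit at position [l] of the union, so strictness is lost. *)
Lemma order_type_le i j :
  i < ones (take l.+1 t) -> twos (take l t) <= j < #|` Y| ->
  nth 0 (sort <=%O X) i <= nth 0 (sort <=%O Y) j.
Proof.
move=> /nthX_take[p lt_p [-> p_z]] /nthY_drop[q /andP[le_q q_z] ->].
have := leq_trans (n := l) lt_p le_q; rewrite leq_eqVlt => /orP[/eqP-> //|lt_pq].
by apply: ltnW; rewrite (sorted_ltn_nth ltn_trans).
Qed.

End Interleaving.

Lemma order_type_ge (X Y : {fset nat}) l i j :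
  j < twos (take l.+1 (order_type X Y)) ->
  ones (take l (order_type X Y)) <= i < #|` X| ->
  nth 0 (sort <=%O Y) j <= nth 0 (sort <=%O X) i.
Proof.
move=> lt_j le_i; apply: (@order_type_le Y X l).
  by rewrite order_typeC -map_take ones_swap12.
by rewrite order_typeC -map_take twos_swap12.
Qed.

Lemma count_take_eq (T : Type) (p : pred T) x0 s i :
  i < count p s ->
  exists2 l, l < size s & count p (take l s) = i /\ p (nth x0 s l).
Proof.
elim: s i => //= x s IHs i; case px: (p x) => /=.
  case: i => [|i lt_i]; first by exists 0; rewrite ?take0.
  by have [l ? [el pl]] := IHs i lt_i; exists l.+1; rewrite //= px el.
by case/IHs=> l lt_l [el pl]; exists l.+1; rewrite //= px el.
Qed.

(** * Block decompositions *)

Lemma blocks_flatten P s Bs : blocks_from P s Bs -> flatten Bs = s.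
Proof.
elim=> //= {}P {}s B {}Bs _ [/prefixP[u ->] _ _] _ ->.
by rewrite drop_size_cat.
Qed.

(* The hypothesis on [P] holds for both kinds of block condition: a further 1
   never spoils it, so a maximal block cannot be followed by a 1. *)
Lemma blocks_next P s Bs i :
  blocks_from P s Bs -> (forall B, P B -> P (rcons B 1)) -> 0 < i < size Bs ->
  nth 1 s (size (flatten (take i Bs))) != 1.
Proof.
move=> blk; elim: blk i => {P s Bs}[|P s B Bs s_neq0 [pB PB maxB] blk IH] i Pcl.
  by rewrite andbF.
have [u es] := prefixP pB.
case: i => //= i; rewrite ltnS size_cat => lt_i.
have eu : drop (size B) s = u by rewrite es drop_size_cat.
rewrite es nth_cat ltnNge leq_addr /= addKn.
rewrite eu in blk IH.
case: i lt_i => [|i] lt_i.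
  (* The remainder [u] cannot be empty, since [lt_i] provides a further block. *)
  rewrite take0 /=; case: u {eu IH} blk es => [|c u] blk es.
    by inversion blk; subst.
  apply/eqP => /= c1; have := maxB (rcons B 1).
  by rewrite size_rcons ltnn es c1 -cat_rcons prefix_prefix Pcl // => /(_ isT isT).
apply: IH => // C /=; rewrite /twos -cats1 count_cat /= => /eqP->.
by rewrite !addn0.
Qed.

Lemma blocks_head P s Bs : blocks_from P s Bs -> 0 < size Bs -> P (head [::] Bs).
Proof. by case=> // {}P {}s B {}Bs _ []. Qed.

(** Sum [twos C = ones B] over consecutive blocks. The twos of the first block stay as a separate
    term because [P] changes along the induction. *)
Lemma twos_blocks P s Bs i :
  blocks_from P s Bs -> i < size Bs ->
  twos (flatten (take i.+1 Bs)) =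
  twos (head [::] Bs) + ones (flatten (take i Bs)).
Proof.
move=> blk; elim: blk i => {P s Bs} // P s B Bs _ _ blk IH [|i] /=.
  by rewrite take0 /= cats0 addn0.
rewrite ltnS => lt_i; rewrite /twos /ones !count_cat.
have := IH i lt_i; rewrite /twos /ones => ->.
have : twos (head [::] Bs) = ones B.
  by apply/eqP/(blocks_head blk); case: (Bs) lt_i.
by rewrite /twos /ones => ->; rewrite addnA.
Qed.

(* [ones - twos] moves by at most 1 per entry, is positive after the first
   entry and never vanishes in between. *)
Lemma ones_gt_twos t l :
  all (mem [:: 1; 2; 3]) t -> ohead t = Some 1 ->
  (forall l, 0 < l < size t -> ones (take l t) <> twos (take l t)) ->
  0 < l < size t -> twos (take l t) < ones (take l t).
Proof.
move=> t123 t_hd t_irr; elim: l => // -[|l] IH lt_l.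
  by case: t t_hd {t123 t_irr IH lt_l} => //= _ s [->]; rewrite take0.
have /andP[_ lt_l'] := lt_l.
have {IH} := IH (ltnW lt_l'); have /eqP := t_irr _ lt_l.
rewrite (take_nth 0 (ltnW lt_l')) /ones /twos -cats1 !count_cat /= !addn0.
have /(allP t123) := mem_nth 0 (ltnW lt_l').
rewrite !inE => /or3P[]/eqP-> /=; rewrite ?addn0 ?addn1 //.
  by move=> _; exact: leqW.
by move=> neq le_ones; rewrite ltn_neqAle eq_sym neq.
Qed.

(** * The homomorphism for primary types *)

Section PrimaryHomomorphism.

Variables (t : seq nat) (k n : nat) (Bs : seq (seq nat)).
Hypothesis t123 : all (mem [:: 1; 2; 3]) t.
Hypothesis ones_t : ones t = k.
Hypothesis twos_t : twos t = k.
Hypothesis t_head : ohead t = Some 1.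
Hypothesis t_irr :
  forall l, 0 < l < size t -> ones (take l t) <> twos (take l t).
Hypothesis t_blocks : primary_blocks t Bs.

Let end_ i := size (flatten (take i Bs)).
(** Chunk [i], counted from 0, occupies the indices from [cut i] up to [(cut i.+1).-1] in the sorted
    set. *)
Let cut i := ones (flatten (take i Bs)).

Let take_end i : take (end_ i) t = flatten (take i Bs).
Proof.
rewrite -(blocks_flatten t_blocks) -{1}(cat_take_drop i Bs) flatten_cat.
by rewrite take_size_cat.
Qed.

(** The first block has no twos, so the extra term of [twos_blocks] vanishes. Hence the same indices
    that cut [X] also cut [Y], one block later. *)
Let twos_cut i : i < size Bs -> twos (flatten (take i.+1 Bs)) = cut i.
Proof.
move=> lt_i; rewrite (twos_blocks t_blocks lt_i) /cut -[RHS]add0n; congr (_ + _).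
have: all (pred1 1) (head [::] Bs).
  by apply: (blocks_head t_blocks); case: (Bs) lt_i.
by rewrite /twos; elim: (head _ _) => //= c s IH /andP[/eqP-> /IH->].
Qed.

Let nth_end i : 0 < i < size Bs -> end_ i < size t /\ nth 0 t (end_ i) \in [:: 2; 3].
Proof.
move=> /(blocks_next t_blocks) next1.
have {next1} next1 : nth 1 t (end_ i) != 1.
  by apply: next1 => B; rewrite all_rcons => ->.
have lt_i : end_ i < size t.
  by rewrite ltnNge; apply: contraNN next1 => /(nth_default 1)->.
split=> //; have /(allP t123) := mem_nth 0 lt_i.
by move: next1; rewrite (set_nth_default 0) // !inE => /negPf->.
Qed.

(** If the first block were empty, [nth_end] would put a 2 or 3 at the head of [t], which is 1. *)
Let end_gt0 i : 0 < i < size Bs -> 0 < end_ i.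
Proof.
move=> /andP[i_gt0 lt_i].
have le_1 : end_ 1 <= end_ i.
  rewrite /end_ -[in X in _ <= X](subnKC i_gt0) takeD flatten_cat.
  by rewrite size_cat leq_addr.
apply: leq_trans le_1; rewrite lt0n; apply/eqP => e0.
have [] : end_ 1 < size t /\ nth 0 t (end_ 1) \in [:: 2; 3].
  by apply: nth_end; apply: leq_ltn_trans lt_i.
by rewrite e0; case: (t) t_head => //= _ s [->].
Qed.

(** At the end of a block other than the last, ones exceed twos, and the twos number [cut i]; so
    these chunks are nonempty. *)
Let cutS i : i.+1 < size Bs -> cut i < cut i.+1.
Proof.
move=> lt_i; rewrite -(twos_cut (ltnW lt_i)) /cut -!take_end.
by apply: ones_gt_twos => //; rewrite end_gt0 //=; case: (@nth_end i.+1).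
Qed.

Let cut_le i : cut i <= k.
Proof.
rewrite -ones_t -(blocks_flatten t_blocks) -{1}(cat_take_drop i Bs).
by rewrite flatten_cat /ones count_cat leq_addr.
Qed.

(** Counting [j] from 0, even coordinates are chunk minima and odd ones chunk maxima; for [coord1]
    the parities are exchanged. *)
Let pos j := if odd j then (cut j./2.+1).-1 else cut j./2.

Let sample (X : {fset nat}) : seq nat :=
  mkseq (fun j => nth 0 (sort <=%O X) (pos j)) (2 * (size Bs).-1 - 1).

Let sample_odd X i :
  i.+1 < size Bs -> coord1 (sample X) (2 * i.+1 - 1) = nth 0 (sort <=%O X) (cut i).
Proof.
move=> lt_i; rewrite /coord1 nth_mkseq; last by lia.
by have -> : (2 * i.+1 - 1).-1 = i.*2 by [lia]; rewrite /pos odd_double doubleK.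
Qed.

Let sample_even X i :
  i.+2 < size Bs ->
  coord1 (sample X) (2 * i.+1) = nth 0 (sort <=%O X) (cut i.+1).-1.
Proof.
move=> lt_i; rewrite /coord1 nth_mkseq; last by lia.
have -> : (2 * i.+1).-1 = i.*2.+1 by lia.
by rewrite /pos /= odd_double /= uphalf_double.
Qed.

Let pos_lt j : j < 2 * (size Bs).-1 - 1 -> pos j < k.
Proof.
move=> lt_j; have lt_i : j./2.+1 < size Bs by lia.
have lt_k := leq_trans (cutS lt_i) (cut_le _).
rewrite /pos; case: odd => //; have := cut_le j./2.+1; lia.
Qed.

Let pos_leS j : j.+1 < 2 * (size Bs).-1 - 1 -> pos j <= pos j.+1.
Proof.
move=> lt_j; have lt_i : j./2.+1 < size Bs by lia.
have := cutS lt_i; rewrite /pos /= uphalf_half.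
by case: odd => /= lt_c; rewrite ?add1n ?add0n; lia.
Qed.

(** Minimum and maximum of a one-element chunk coincide, but minima of successive chunks increase
    strictly by [cutS]. *)
Let sample_in_V (X : ksubset n k) : in_V (size Bs).-1 n (sample (val X)).
Proof.
case: X => X /= /andP[/fsubsetP X_n /eqP X_k].
have X_sorted := sorted_ltn_fset X.
have X_size : size (sort <=%O X) = k by rewrite size_sort.
have nth_lt p q : p < q < k -> nth 0 (sort <=%O X) p < nth 0 (sort <=%O X) q.
  move=> /andP[lt_pq lt_q].
  by apply: (sorted_ltn_nth ltn_trans 0 X_sorted) => //; rewrite inE X_size; lia.
apply/and3P; split.
- apply/allP => c /mapP[j]; rewrite mem_iota => /pos_lt lt_k ->.
  have := @mem_nth _ 0 (sort <=%O X) (pos j); rewrite X_size => /(_ lt_k).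
  by rewrite mem_sort => /X_n; rewrite !inE mem_iota add1n ltnS.
- apply/(sortedP 0) => j; rewrite size_mkseq => lt_j.
  rewrite !nth_mkseq ?(ltnW lt_j) //.
  have := pos_leS lt_j; rewrite leq_eqVlt => /orP[/eqP-> //|lt_p].
  by apply/ltnW/nth_lt; rewrite lt_p pos_lt.
- apply/(sortedP 0) => j; rewrite size_map size_iota => lt_j.
  rewrite !(nth_map 0) ?size_iota ?(ltnW lt_j) // !nth_iota ?(ltnW lt_j) // !add1n.
  rewrite !sample_odd; try lia.
  by apply: nth_lt; rewrite cutS ?(leq_trans (cutS _) (cut_le _)) //; lia.
Qed.

Let card_order_type (X Y : {fset nat}) :
  order_type X Y = t -> #|` X| = k /\ #|` Y| = k.
Proof.
by move=> XYt; rewrite -{1}ones_t -twos_t -XYt ones_order_type twos_order_type.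
Qed.

Let min_lt_max i : i.+1 < size Bs -> (cut i.+1).-1 < cut i.+1.
Proof. by move=> lt_i; rewrite ltn_predL (leq_trans _ (cutS lt_i)). Qed.

(** The first [i.+1] blocks contain the element of [X], but by [twos_cut] only [cut i] elements of
    [Y]. *)
Let block_lt (X Y : {fset nat}) i p :
  order_type X Y = t -> i.+1 < size Bs -> p < cut i.+1 ->
  nth 0 (sort <=%O X) p < nth 0 (sort <=%O Y) (cut i).
Proof.
move=> XYt lt_i lt_p; have [_ card_Y] := card_order_type XYt.
apply: (@order_type_lt X Y (end_ i.+1)); rewrite XYt take_end //.
by rewrite (twos_cut (ltnW lt_i)) leqnn /= card_Y (leq_trans (cutS lt_i)).
Qed.

(** The entry at [end_ i.+1] is 2 or 3, so it is the element of [Y] in question; the element of [X]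
    comes no earlier. *)
Let min_le_min (X Y : {fset nat}) i :
  order_type X Y = t -> i.+2 < size Bs ->
  nth 0 (sort <=%O Y) (cut i) <= nth 0 (sort <=%O X) (cut i.+1).
Proof.
move=> XYt lt_i; have [card_X _] := card_order_type XYt.
have [lt_e nth_e] : end_ i.+1 < size t /\ nth 0 t (end_ i.+1) \in [:: 2; 3].
  by apply: nth_end; rewrite /= ltnW.
apply: (@order_type_ge X Y (end_ i.+1)); rewrite XYt.
  rewrite (take_nth 0) // take_end /twos -cats1 count_cat -/(twos _).
  by rewrite (twos_cut (ltnW (ltnW lt_i))) /= addn0 -addn1 leq_add2l nth_e.
by rewrite take_end leqnn /= card_X (leq_trans (cutS lt_i)).
Qed.

(** Let [l] be the position of the element of [X]. The prefix before it has [cut i.+1] ones and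
    strictly fewer twos, so the element of [Y] is at [l] or later. *)
Let min_le_max (X Y : {fset nat}) i :
  order_type X Y = t -> i.+2 < size Bs ->
  nth 0 (sort <=%O X) (cut i.+1) <= nth 0 (sort <=%O Y) (cut i.+1).-1.
Proof.
move=> XYt lt_i; have [_ card_Y] := card_order_type XYt.
have lt_k : cut i.+1 < k by apply: leq_trans (cutS lt_i) _.
have cut_gt0 : 0 < cut i.+1 by apply: leq_trans (cutS (ltnW lt_i)).
have [l lt_l [el pl]] : exists2 l, l < size t &
    ones (take l t) = cut i.+1 /\ nth 0 t l \in [:: 1; 3].
  by apply: (@count_take_eq _ (mem [:: 1; 3]) 0); rewrite -/(ones t) ones_t.
apply: (@order_type_le X Y l); rewrite XYt.
  by rewrite (take_nth 0) // /ones -cats1 count_cat -/(ones _) el /= pl addn1.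
rewrite card_Y (leq_trans _ lt_k) ?ltnS ?leq_pred // andbT.
rewrite -ltnS prednK // -el; apply: ones_gt_twos => //.
by rewrite lt_l andbT; case: l el {lt_l pl} cut_gt0 => // <-; rewrite take0.
Qed.

Let sample_arc (X Y : {fset nat}) :
  order_type X Y = t -> G_arc (size Bs).-1 (sample X) (sample Y).
Proof.
move=> XYt; split=> [[//|i] /= lt_i|[//|i] /= lt_i|j /andP[j_gt0 le_j]].
- rewrite !sample_odd; try lia.
  by apply: block_lt; [by []|lia | apply: cutS; lia].
- have -> : 2 * i.+1 + 1 = 2 * i.+2 - 1 by lia.
  by rewrite !sample_odd; try lia; apply: min_le_min => //; lia.
(* For odd [j], a maximum of [X] meets the minimum of the same chunk of [Y]; for even [j], the
   minimum of the next chunk of [X] meets a maximum of [Y]. *)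
have [[i ej]|[i ej]] : (exists i, j = 2 * i.+1 - 1) \/ (exists i, j = 2 * i.+1).
  by case: (boolP (odd j)) => odd_j; [left; exists j./2 | right; exists j./2.-1]; lia.
- have ej1 : j.+1 = 2 * i.+1 by lia.
  rewrite ej1 ej sample_even ?sample_odd; try lia.
  by apply/ltnW/block_lt; [by []|lia | apply: min_lt_max; lia].
- have ej1 : j.+1 = 2 * i.+2 - 1 by lia.
  rewrite ej1 ej sample_even ?sample_odd; try lia.
  by apply: min_le_max => //; lia.
Qed.

(* A [k]-set [X] is cut into consecutive chunks of sizes [ones B_1], ...,
   [ones B_(b-1)]; [phi X] lists the minimum and maximum of each chunk, except
   for the last maximum. *)
Lemma primary_homomorphism :
  exists phi : ksubset n k -> V (size Bs).-1 n, forall X Y,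
    order_type (val X) (val Y) = t -> G_arc (size Bs).-1 (val (phi X)) (val (phi Y)).
Proof.
have sample_size X : size (sample X) == 2 * (size Bs).-1 - 1 by rewrite size_mkseq.
exists (fun X => exist _ (Tuple (sample_size (val X))) (sample_in_V X)) => X Y.
exact: sample_arc.
Qed.

End PrimaryHomomorphism.

(** * Both kinds of types together *)

Theorem theorem4p2 (t : seq nat) (k b n : nat) (Bs : seq (seq nat))
  (t_width : type_of_width k t)
  (t_nontrivial : ~~ trivial_type t)
  (t_irreducible : irreducible t)
  (t_blocks : block_decomposition t Bs)
  (Bs_size : size Bs = b)
  (b_ge2 : 2 <= b)
  (n_gt0 : 0 < n)
  (le_k_n : k <= n) :
  exists phi : vertex (type_graph n k t) -> vertex (G_graph b.-1 n),
    is_homomorphism phi.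
Proof.
have [Xt [Yt [Xk Yk XYt]]] := t_width.
have t123 : all (mem [:: 1; 2; 3]) t by rewrite -XYt all_order_type.
have ones_t : ones t = k by rewrite -XYt ones_order_type.
have twos_t : twos t = k by rewrite -XYt twos_order_type.
have t_prefix l : 0 < l < size t -> ones (take l t) <> twos (take l t).
  exact: irreducible_prefix.
case: t_blocks => [[[_ _ t_head] blk]|[[_ _ t_head] [Cs blk eBs]]].
  have [phi phiP] := primary_homomorphism n t123 ones_t twos_t t_head t_prefix blk.
  rewrite -Bs_size; exists phi => X Y [/phiP|/phiP]; by [left | right].
have Cs_size : size Cs = b by rewrite -Bs_size eBs size_map.
have [] := @primary_homomorphism (map swap12 t) k n Cs.
- by rewrite -XYt -order_typeC all_order_type.
- by rewrite ones_swap12.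
- by rewrite twos_swap12.
- by case: (t) t_head => //= _ s [->].
- move=> l; rewrite size_map -map_take ones_swap12 twos_swap12.
  by move=> /t_prefix/nesym.
- exact: blk.
(* Swapping the type swaps the arguments of [order_type], so each arc is reversed. *)
rewrite Cs_size => phi phiP; exists phi => X Y [] eXY; [right | left];
  by apply: phiP; rewrite order_typeC eXY.
Qed.
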